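(* Let $V\subseteq \mathrm{GF}(2)^E$ and $V'\subseteq \mathrm{GF}(2)^{E'}$ be pedestrian subspaces (for finite sets $E,E'$). Then the matroid $M(V)$ is isomorphic to $M(V')$ if and only if the graph $G_V$ is isomorphic to $G_{V'}$.
   Context: For $v\in\mathrm{GF}(2)^E$, $\mathrm{supp}(v)=\{e: v_e\neq0\}$; $M(V)$ is the matroid on $E$ whose independent sets are the $F\subseteq E$ such that no nonzero $v\in V$ has $\mathrm{supp}(v)\subseteq F$. With $b(x,y)=\sum_e x_ey_e$ and $V^\perp=\{w:b(w,v)=0\ \forall v\in V\}$, $V$ is pedestrian if $V\cap V^\perp=\{0\}$. Then $\mathrm{GF}(2)^E=V\oplus V^\perp$ and $\pi_V:\mathrm{GF}(2)^E\to V$ is the linear projection with $\pi_V(x)\in V$ and $x-\pi_V(x)\in V^\perp$; $Q_V$ is the $E\times E$ matrix with $\pi_V(x)=Q_Vx$. $G_V$ is the support graph of $Q_V$: vertex set $E$ and edge set $\{ef : (Q_V)_{ef}\neq 0\}$, where $e,f\in E$ range over all pairs including $e=f$ (so there is a loop at $e$ exactly when $(Q_V)_{ee}\neq0$). *)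

(* Defs.v *)
From HB Require Import structures.
From mathcomp Require Import all_boot all_algebra.

Set Implicit Arguments.
Unset Strict Implicit.
Unset Printing Implicit Defensive.

Import GRing.Theory.
Local Open Scope ring_scope.

(* The regular algebra ('F_2)^o, rather than 'F_2, carries the vectType structure
   over 'F_2 that makes the functions E -> GF(2) a vector space. *)
Notation gf2 E := {ffun E -> ('F_2)^o}.

Record matroid (E : finType) := Matroid {
  indep : {set {set E}};
  indep_set0 : set0 \in indep;
  indep_sub : forall A B : {set E}, A \subset B -> B \in indep -> A \in indep;
  indep_aug : forall A B : {set E}, A \in indep -> B \in indep ->
    (#|A| < #|B|)%N -> exists2 e, e \in B :\: A & e |: A \in indep }.

Definition matroid_iso (E E' : finType) (M : matroid E) (M' : matroid E') :=
  exists2 phi : E -> E', bijective phi &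
    forall A : {set E}, (A \in indep M) = (phi @: A \in indep M').

(* Graphs with loops allowed and without parallel edges are given by their
   adjacency relation; a loop at e is g e e. *)
Definition graph_iso (E E' : finType) (g : rel E) (g' : rel E') :=
  exists2 phi : E -> E', bijective phi &
    forall e f : E, g e f = g' (phi e) (phi f).

Section Pedestrian.
Variable E : finType.
Implicit Types (x y v w : gf2 E) (V : {vspace gf2 E}) (A B F : {set E}).

Definition supp v : {set E} := [set e | v e != 0].

Definition bform x y : 'F_2 := \sum_e x e * y e.

Definition unitv (e : E) : gf2 E := [ffun f => (f == e)%:R].

Lemma bformC x y : bform x y = bform y x.
Proof. by apply: eq_bigr => e _; rewrite mulrC. Qed.

Definition bformr y x : ('F_2)^o := bform x y.

Fact bformr_linear y : linear (bformr y).
Proof.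
move=> a u v; rewrite /bformr /bform scaler_sumr -big_split /=.
by apply: eq_bigr => e _; rewrite !ffunE mulrDl -scalerAl.
Qed.
HB.instance Definition _ y :=
  GRing.isLinear.Build 'F_2 (gf2 E) ('F_2)^o *:%R (bformr y) (bformr_linear y).

Definition orthov V : {vspace gf2 E} :=
  (\bigcap_(v | v \in V) lker (linfun (bformr v)))%VS.

Lemma orthovP V w :
  reflect (forall v, v \in V -> bform w v = 0) (w \in orthov V).
Proof.
have H v : (w \in lker (linfun (bformr v))) = (bform w v == 0).
  by rewrite memv_ker lfunE.
rewrite memvE; apply: (iffP subv_bigcapP) => h v /h.
  by rewrite -memvE H => /eqP.
by rewrite -memvE H => ->.
Qed.

Definition pedestrian V := (V :&: orthov V = 0)%VS.

(* daddv_pi V W is the projection onto V along W when V and W are disjoint. *)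
Definition projV V : 'End(gf2 E) := daddv_pi V (orthov V).

Lemma orthov_add V : pedestrian V -> (V + orthov V = fullv)%VS.
Proof.
move=> pV; apply/eqP; rewrite eqEdim subvf dimv_disjoint_sum //=.
pose g x : {ffun 'I_(\dim V) -> ('F_2)^o} :=
  [ffun i : 'I_(\dim V) => bformr (vbasis V)`_i x].
have g_lin : linear g by move=> a u v; apply/ffunP => i; rewrite !ffunE linearP.
pose gL := GRing.isLinear.Build _ _ _ _ g g_lin.
pose gl : {linear gf2 E -> {ffun 'I_(\dim V) -> ('F_2)^o}} := HB.pack g gL.
have kg : (lker (linfun gl) <= orthov V)%VS.
  apply/subvP => x; rewrite memv_ker lfunE => /eqP gx; apply/orthovP => v vV.
  rewrite (coord_vbasis vV) bformC -[bform _ _]/(bformr x _) linear_sum big1 // => i _.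
  rewrite linearZ /= /bformr bformC.
  by have /ffunP /(_ i) := gx; rewrite !ffunE /bformr => ->; rewrite scaler0.
rewrite -(limg_ker_dim (linfun gl) fullv) capfv addnC.
apply: leq_add; last exact: dimvS.
by apply: leq_trans (dimvS (subvf _)) _; rewrite dimvf /dim /= card_ord muln1.
Qed.

Lemma projV_in V x : projV V x \in V.
Proof. exact: memv_pi. Qed.

Lemma projV_orth V x : pedestrian V -> x - projV V x \in orthov V.
Proof.
move=> pV; have := @daddv_pi_add _ _ V (orthov V) x pV.
rewrite orthov_add // memvf => /(_ isT) {1}<-.
by rewrite [_ + _ in X in X - _]addrC addrK memv_pi.
Qed.

Definition Qmat V (e f : E) : 'F_2 := projV V (unitv f) e.

Definition support_graph V : rel E := [rel e f | Qmat V e f != 0].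

Definition indepV V : {set {set E}} :=
  [set F : {set E} |
    [forall v : gf2 E, (v \in V) ==> (v != 0) ==> ~~ (supp v \subset F)]].

Lemma indepVP V F :
  reflect (forall v, v \in V -> supp v \subset F -> v = 0) (F \in indepV V).
Proof.
rewrite inE; apply: (iffP forallP) => h v.
  move=> vV vF; apply/eqP; apply: contraTT vF => v0.
  by have := h v; rewrite vV v0.
apply/implyP => vV; apply/implyP; apply: contraNN => vF.
by apply/eqP; apply: h.
Qed.

Lemma gf2_sum x : x = \sum_e x e *: unitv e.
Proof.
apply/ffunP => f; rewrite sum_ffunE (bigD1 f) //= big1 => [|e ne].
  by rewrite !ffunE eqxx addr0 [_ *: _]mulr1.
by rewrite !ffunE eq_sym (negbTE ne) scaler0.
Qed.

Lemma projV_Qmat V x e : projV V x e = \sum_f Qmat V e f * x f.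
Proof.
rewrite [in LHS](gf2_sum x) linear_sum sum_ffunE; apply: eq_bigr => f _.
by rewrite linearZ /= ffunE mulrC.
Qed.

Lemma Qmat_sym V e f : pedestrian V -> Qmat V e f = Qmat V f e.
Proof.
move=> pV; have bu (x : gf2 E) g : bform x (unitv g) = x g.
  rewrite /bform (bigD1 g) //= big1 => [|h hg].
    by rewrite ffunE eqxx mulr1 addr0.
  by rewrite ffunE (negbTE hg) mulr0.
have sa x y : bform (projV V x) y = bform (projV V x) (projV V y).
  have /orthovP /(_ _ (projV_in V x)) := projV_orth y pV.
  rewrite -[bform _ _]/(bformr _ _) linearB /= /bformr => /eqP.
  by rewrite subr_eq0 !(bformC (projV V x)) => /eqP.
by rewrite /Qmat -bu sa bformC -sa bu.
Qed.

Lemma support_graph_sym V : pedestrian V -> symmetric (support_graph V).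
Proof. by move=> pV e f; rewrite /support_graph /= (Qmat_sym e f pV). Qed.

Definition unitvs F := [seq unitv e | e <- enum F].

Lemma mem_unitvs F v : supp v \subset F -> v \in <<unitvs F>>%VS.
Proof.
move=> /subsetP vF; rewrite (gf2_sum v); apply: memv_suml => e _.
have [->|ve] := eqVneq (v e) 0; first by rewrite scale0r mem0v.
apply/memvZ/memv_span/map_f; rewrite mem_enum; apply: vF.
by rewrite inE.
Qed.

Lemma supp_unitvs F v : v \in <<unitvs F>>%VS -> supp v \subset F.
Proof.
move=> /coord_span ->; apply/subsetP => e; rewrite inE; apply: contraNT => eF.
rewrite sum_ffunE big1 // => i _; rewrite ffunE.
have /mapP [f] : (unitvs F)`_i \in unitvs F.
  by apply: mem_nth; rewrite size_map -cardE ltn_ord.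
rewrite mem_enum /= => fF ->; rewrite ffunE; case: eqP => [ef|_].
  by rewrite ef fF in eF.
by rewrite scaler0.
Qed.

Lemma dim_unitvs F : \dim <<unitvs F>> = #|F|.
Proof.
suff : free (unitvs F) by move=> /eqP ->; rewrite size_map cardE.
have := enum_uniq F; rewrite /unitvs; elim: (enum F) => [|e s IH] /= => [_|/andP[es us]]; first exact: nil_free.
rewrite free_cons IH // andbT; apply/negP => ein.
have /supp_unitvs /subsetP /(_ e) : unitv e \in <<unitvs [set f in s]>>%VS.
  apply: subvP ein; apply: sub_span => x /mapP [f fs ->].
  by apply: map_f; rewrite mem_enum inE.
by rewrite !inE ffunE eqxx oner_eq0 (negbTE es) => /(_ isT).
Qed.

Lemma indepV_cap V F : F \in indepV V -> (V :&: <<unitvs F>> = 0)%VS.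
Proof.
move=> /indepVP h; apply/eqP; rewrite -subv0; apply/subvP => v.
by rewrite memv_cap memv0 => /andP[vV /supp_unitvs vF]; rewrite (h v).
Qed.

Fact indepV_set0 V : set0 \in indepV V.
Proof.
apply/indepVP => v _ /subsetP v0; apply/ffunP => e; rewrite ffunE.
by apply/eqP; apply: contraT => ve; have := v0 e; rewrite !inE ve => /(_ isT).
Qed.

Fact indepV_sub V A B : A \subset B -> B \in indepV V -> A \in indepV V.
Proof.
move=> AB /indepVP h; apply/indepVP => v vV vA; apply: h => //.
exact: subset_trans AB.
Qed.

Fact indepV_aug V A B : A \in indepV V -> B \in indepV V ->
  (#|A| < #|B|)%N -> exists2 e, e \in B :\: A & e |: A \in indepV V.
Proof.
move=> iA iB ltAB.
have [/exists_inP //|] := boolP [exists e in B :\: A, e |: A \in indepV V].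
rewrite negb_exists_in => /forall_inP nx; move: ltAB; rewrite ltnNge => /negP[].
rewrite -(leq_add2l (\dim V)) -!dim_unitvs -!dimv_disjoint_sum ?indepV_cap //.
apply: dimvS; rewrite subv_add addvSl /=; apply/span_subvP => x /mapP [e].
rewrite mem_enum => eB ->{x}.
have [eA|eA] := boolP (e \in A).
  by apply: subvP (addvSr _ _) _ _; apply/memv_span/map_f; rewrite mem_enum.
have := nx e; rewrite inE eA eB => /(_ isT).
rewrite inE negb_forall => /existsP [v].
case: (boolP (v \in V)) => // vV; case: eqVneq => //= v0 /negPn vF.
have ve : v e != 0.
  apply: contraNneq v0 => ve; apply/eqP; move/indepVP: iA; apply=> //.
  apply/subsetP => f fv; move/subsetP: vF => /(_ f fv).
  by rewrite in_setU1 => /orP [/eqP fe|//]; rewrite fe inE ve eqxx in fv.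
have /mem_unitvs : supp (v e *: unitv e - v) \subset A.
  apply/subsetP => f; rewrite inE => h.
  have [fe|fe] := eqVneq f e.
    by move: h; rewrite fe !ffunE eqxx [_ *: _]mulr1 subrr eqxx.
  move/subsetP: vF => /(_ f); rewrite in_setU1 (negbTE fe); apply.
  by move: h; rewrite inE !ffunE (negbTE fe) scaler0 sub0r oppr_eq0.
move=> h; rewrite -(scale1r (unitv e)) -(mulVf ve) -scalerA; apply: memvZ.
by rewrite -(subrK v (_ *: _)) addrC memv_add.
Qed.

Definition M_of V : matroid E :=
  Matroid (indepV_set0 V) (@indepV_sub V) (@indepV_aug V).

End Pedestrian.

(* Main.v *)
Require Import Defs.
From mathcomp Require Import all_boot all_algebra.

(* Over GF(2) a vector is its support, and V is spanned by its vectors of minimal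
   support, i.e. by the circuits of M(V); so M(V) determines V.  When V is
   pedestrian, V and the projection matrix Q_V determine each other (V is the
   fixed space of Q_V), and a matrix over GF(2) is its support graph.  Hence a
   bijection of the ground sets is an isomorphism of the matroids iff it maps
   one subspace onto the other iff it is an isomorphism of the graphs. *)

Set Implicit Arguments.
Unset Strict Implicit.
Unset Printing Implicit Defensive.

Import GRing.Theory Defs.
Local Open Scope ring_scope.

(** The only nonzero scalar is 1. Through this fact supports determine vectors and support graphs
    determine matrices. *)
Lemma F2_natr_neq0 (a : 'F_2) : a = (a != 0)%:R.
Proof. by case: a => [[|[|//]] i]; apply: val_inj. Qed.

Section Subspace.
Variable E : finType.
Implicit Types (x y v w : gf2 E) (V : {vspace gf2 E}).

Lemma supp_inj : injective (@supp E).
Proof.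
move=> x y /setP xy; apply/ffunP => e; have := xy e; rewrite !inE => xye.
by rewrite (F2_natr_neq0 (x e)) (F2_natr_neq0 (y e)) xye.
Qed.

Lemma projV_id V x : pedestrian V -> x \in V -> projV V x = x.
Proof. exact: daddv_pi_id. Qed.

Lemma projV_orthov V x : pedestrian V -> x \in orthov V -> projV V x = 0.
Proof.
move=> pV xV; apply/eqP; rewrite -memv0 -pV memv_cap projV_in /=.
by rewrite -(subKr x (projV V x)) rpredB ?projV_orth.
Qed.

Lemma projV_unique V x v :
  pedestrian V -> v \in V -> x - v \in orthov V -> projV V x = v.
Proof.
move=> pV vV xvV; rewrite -(subrK v x) linearD /=.
by rewrite projV_orthov // projV_id // add0r.
Qed.

Lemma depVP V (F : {set E}) :
  reflect (exists2 v, v \in V & v != 0 /\ supp v \subset F) (F \notin indepV V).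
Proof.
rewrite inE negb_forall; apply: (iffP existsP) => [[v]|[v vV [v0 vF]]].
  by rewrite 2!negb_imply negbK => /and3P[]; exists v.
by exists v; rewrite vV v0 vF.
Qed.

End Subspace.

Section Pullback.
Variables (E E' : finType) (phi : E -> E').

(** Relabelling of coordinates along [phi], contravariant so that supports become preimages. *)
Definition pull (y : gf2 E') : gf2 E := [ffun e => y (phi e)].

Lemma pullB y z : pull (y - z) = pull y - pull z.
Proof. by apply/ffunP => e; rewrite !ffunE. Qed.

Lemma supp_pull y : supp (pull y) = phi @^-1: supp y.
Proof. by apply/setP => e; rewrite !inE ffunE. Qed.

Lemma pull_unitv f : injective phi -> pull (unitv (phi f)) = unitv f.
Proof. by move=> phiI; apply/ffunP => e; rewrite !ffunE (inj_eq phiI). Qed.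

Lemma bform_pull y z : bijective phi -> bform (pull y) (pull z) = bform y z.
Proof.
move=> phiB; rewrite /bform [RHS](reindex phi); last exact: onW_bij.
by apply: eq_bigr => e _; rewrite !ffunE.
Qed.

End Pullback.

Lemma pullK (E E' : finType) (phi : E -> E') (psi : E' -> E) :
  cancel psi phi -> cancel (pull phi) (pull psi).
Proof. by move=> psiK y; apply/ffunP => e; rewrite !ffunE psiK. Qed.

Section OneWay.
Variables (E E' : finType) (phi : E -> E') (psi : E' -> E).
Hypotheses (phiK : cancel phi psi) (psiK : cancel psi phi).
Variables (V : {vspace gf2 E}) (V' : {vspace gf2 E'}).

Let phiB : bijective phi. Proof. by exists psi. Qed.

Lemma indepV_pull (B : {set E'}) :
  (forall y, y \in V' -> pull phi y \in V) ->
  phi @^-1: B \in indepV V -> B \in indepV V'.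
Proof.
move=> VV' /indepVP iB; apply/indepVP => y yV' yB.
apply: (can_inj (pullK psiK)).
rewrite (iB (pull phi y)) ?VV' ?supp_pull ?preimsetS //.
by apply/ffunP => e; rewrite !ffunE.
Qed.

(* Subtracting from y a vector of V' whose support is a circuit inside supp y
   shrinks the support. *)
Lemma pull_indepV :
  (forall B : {set E'}, (B \in indepV V') = (phi @^-1: B \in indepV V)) ->
  forall y, y \in V' -> pull phi y \in V.
Proof.
move=> iVV' y; have [n] := ubnP #|supp y|; elim: n => // n IH in y *.
rewrite ltnS => yn yV'.
have [->|y0] := eqVneq y 0.
  by rewrite (_ : pull phi 0 = 0) ?mem0v //; apply/ffunP => e; rewrite !ffunE.
pose P w := [&& w \in V', w != 0 & supp w \subset supp y].
have Py : P y by rewrite /P yV' y0 subxx.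
pose w := [arg min_(z < y | P z) #|supp z|].
have [Pw wmin] : P w /\ forall z, P z -> (#|supp w| <= #|supp z|)%N.
  by rewrite /w; case: arg_minnP.
have /and3P[wV' w0 wy] := Pw.
(* Dependence of [supp w] passes to [V] and yields [u]; dependence of [supp (pull psi u)] passes
   back and yields [z]. Minimality of [w] against [z] forces [supp w = supp (pull psi u)], so
   [pull phi w] is [u]. *)
have pwV : pull phi w \in V.
  have : supp w \notin indepV V' by apply/depVP; exists w.
  rewrite iVV' => /depVP[u uV [u0 uw]].
  have us : supp u = phi @^-1: supp (pull psi u).
    by rewrite -supp_pull (pullK phiK).
  have : supp (pull psi u) \notin indepV V'.
    by rewrite iVV' -us; apply/depVP; exists u.
  case/depVP => z zV' [z0 zu].
  have uw' : supp (pull psi u) \subset supp w.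
    apply/subsetP => e; rewrite supp_pull inE => /(subsetP uw).
    by rewrite inE psiK.
  have Pz : P z by rewrite /P zV' z0 (subset_trans zu) // (subset_trans uw').
  suff -> : w = pull psi u by rewrite (pullK phiK).
  apply: supp_inj; apply/esym/eqP; rewrite eqEcard uw'.
  exact: leq_trans (wmin z Pz) (subset_leq_card zu).
rewrite -(subrK (pull phi w) (pull phi y)) rpredD // -pullB.
apply: IH; last exact: rpredB.
apply: leq_trans yn; apply: proper_card; apply/properP.
(* On [supp w] both vectors equal 1, so they cancel there. *)
have yw e : e \in supp w -> (y - w) e = 0.
  move=> ew; have := subsetP wy e ew; rewrite inE in ew; rewrite inE => ey.
  by rewrite !ffunE (F2_natr_neq0 (y e)) (F2_natr_neq0 (w e)) ew ey subrr.
split.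
  apply/subsetP => e; rewrite inE; have [/yw->|ew] := boolP (e \in supp w).
    by rewrite eqxx.
  by move: ew; rewrite !inE !ffunE negbK => /eqP->; rewrite subr0.
have [e ew] : exists e, e \in supp w.
  apply/set0Pn; apply: contraNneq w0 => ws; apply/eqP/supp_inj.
  by rewrite ws; apply/setP => e; rewrite !inE ffunE eqxx.
by exists e; [exact: (subsetP wy) | rewrite inE yw ?eqxx].
Qed.

(** A vector of [V'] is fixed by its projection; with matching matrices its pullback is fixed by
    [projV V], hence lies in the image [V]. *)
Lemma pull_Qmat :
  pedestrian V' -> (forall e f, Qmat V e f = Qmat V' (phi e) (phi f)) ->
  forall y, y \in V' -> pull phi y \in V.
Proof.
move=> pV' Q y yV'; rewrite (_ : pull phi y = projV V (pull phi y)) ?projV_in //.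
apply/ffunP => e; rewrite ffunE -{1}(projV_id pV' yV') !projV_Qmat.
rewrite (reindex phi); last exact: onW_bij.
by apply: eq_bigr => f _; rewrite ffunE Q.
Qed.

(** Relabelling preserves the bilinear form, so it carries the orthogonal decomposition of
    [unitv (phi f)] along [V'] to that of [unitv f] along [V], which is unique. *)
Lemma Qmat_pull :
  pedestrian V -> pedestrian V' ->
  (forall y, y \in V' -> pull phi y \in V) ->
  (forall x, x \in V -> pull psi x \in V') ->
  forall e f, Qmat V e f = Qmat V' (phi e) (phi f).
Proof.
move=> pV pV' VV' V'V e f; rewrite /Qmat -(pull_unitv f (can_inj phiK)).
rewrite (@projV_unique _ V _ (pull phi (projV V' (unitv (phi f))))) ?ffunE //.
  exact/VV'/projV_in.
rewrite -pullB; apply/orthovP => v vV.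
(* Writing [v] as a pullback moves the orthogonality test to [V']. *)
rewrite -(pullK phiK v) bform_pull //.
exact: (orthovP _ _ (projV_orth (unitv (phi f)) pV')) (V'V v vV).
Qed.

End OneWay.

Theorem theorem7 (E E' : finType)
    (V : {vspace gf2 E}) (V' : {vspace gf2 E'})
    (pedV : pedestrian V) (pedV' : pedestrian V') :
  matroid_iso (M_of V) (M_of V') <->
  graph_iso (support_graph V) (support_graph V').
Proof.
split=> -[phi phiB iso]; exists phi => //; case: (phiB) => psi phiK psiK.
  have iVV' (B : {set E'}) : (B \in indepV V') = (phi @^-1: B \in indepV V).
    by rewrite [RHS]iso -(can2_imset_pre _ psiK phiK) -imset_comp
      (eq_imset _ psiK) imset_id.
  have iV'V (A : {set E}) : (A \in indepV V) = (psi @^-1: A \in indepV V').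
    by rewrite -(can2_imset_pre _ phiK psiK) -iso.
  have VV' := pull_indepV phiK psiK iVV'.
  have V'V := pull_indepV psiK phiK iV'V.
  by move=> e f; congr (_ != 0); apply: (Qmat_pull phiK psiK).
(* Adjacency records only which entries are nonzero, which over GF(2) fixes the entries. *)
have Q e f : Qmat V e f = Qmat V' (phi e) (phi f).
  by rewrite (F2_natr_neq0 (Qmat V e f)) (F2_natr_neq0 (Qmat V' _ _)) [_ != 0]iso.
have Q' e f : Qmat V' e f = Qmat V (psi e) (psi f) by rewrite Q !psiK.
have VV' := pull_Qmat phiK psiK pedV' Q.
have V'V := pull_Qmat psiK phiK pedV Q'.
move=> A /=; have pA : phi @^-1: (phi @: A) = A.
  by apply/setP => e; rewrite inE mem_imset //; apply: can_inj phiK.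
apply/idP/idP => [iA|iA].
  by apply: (indepV_pull psiK VV'); rewrite pA.
by apply: (indepV_pull phiK V'V); rewrite -(can2_imset_pre _ phiK psiK).
Qed.
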